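(* Let $n,k\ge 1$ be integers with $k=\lfloor n/3\rfloor$. Let $C_n=(V,\sigma,\mu)$ be a fuzzy cycle with $n$ vertices, $C_n:u_1,u_2,\ldots,u_n,u_1$, of size $q$, with at least two edges of minimum weight. Then $$\gamma_{snR}(C_n)\le\left(1-\frac{k}{n}\right)\left(q-(\mu_{\max}-\mu_{\min})\right).$$
   Context: A fuzzy graph $G=(V,\sigma,\mu)$ consists of a finite nonempty set $V$, a function $\sigma:V\to[0,1]$, and a symmetric function $\mu:V\times V\to[0,1]$ with $\mu(x,x)=0$ and $\mu(x,y)\le \min\{\sigma(x),\sigma(y)\}$ for all $x,y\in V$. An edge is an unordered pair $(u,v)$ of distinct vertices with $\mu(u,v)>0$, and $\mu(u,v)$ is its weight. The size $q$ is the sum of the weights of all edges, each edge counted once. The strength of a path $x_0,x_1,\ldots,x_m$ (with every $\mu(x_{i-1},x_i)>0$) is $\min_i \mu(x_{i-1},x_i)$, and $CONN_G(u,v)$ is the maximum strength of all $u$–$v$ paths. An edge $(u,v)$ is strong if $\mu(u,v)=CONN_G(u,v)$; then $u,v$ are strong neighbors. $N_s(u)$ is the set of strong neighbors of $u$, and $\mu_s(u)=\min\{\mu(u,v):v\in N_s(u)\}$. $\mu_{\min}$ and $\mu_{\max}$ are the minimum and maximum weight of a strong edge. A fuzzy cycle $C_n:u_1,\ldots,u_n,u_1$ ($n\ge3$) is a fuzzy graph with vertex set $V=\{u_1,\ldots,u_n\}$ ($n$ distinct vertices) whose edges are exactly $(u_i,u_{i+1})$ for $1\le i\le n-1$ and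 $(u_n,u_1)$. A strong-neighbors Roman dominating function (SNRDF) on $G$ is a function $f:V\to\{0,1,2\}$ such that every $u$ with $f(u)=0$ has some $v\in N_s(u)$ with $f(v)=2$. Its weight is $w(f)=\sum_{u\in V}f(u)\mu_s(u)$, and $\gamma_{snR}(G)$ is the minimum weight of an SNRDF on $G$. *)

(* Defs.v *)
From mathcomp Require Import all_boot all_order all_algebra.
From mathcomp Require Import boolp classical_sets reals.

Set Implicit Arguments.
Unset Strict Implicit.
Unset Printing Implicit Defensive.

Import Order.TTheory GRing.Theory Num.Theory.
Local Open Scope ring_scope.

Record fuzzyGraph (R : realType) (V : finType) := FuzzyGraph {
  sigma : V -> R;
  mu : V -> V -> R;
  vertices_gt0 : (0 < #|V|)%N;
  sigma_bound : forall x, 0 <= sigma x <= 1;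
  mu_bound : forall x y, 0 <= mu x y <= 1;
  mu_sym : forall x y, mu x y = mu y x;
  mu_diag : forall x, mu x x = 0;
  mu_sigma : forall x y, mu x y <= Num.min (sigma x) (sigma y)
}.

Section FuzzyGraph.
Context {R : realType} {V : finType}.
Variable G : fuzzyGraph R V.

(* Adjacent vertices are automatically distinct, by [mu_diag]. *)
Definition edge : rel V := fun x y => 0 < mu G x y.

(* Each unordered edge is represented once, by its ordered pair of ends that is
   increasing for the enumeration of V. *)
Definition edges : {set V * V} :=
  [set e : V * V | (enum_rank e.1 < enum_rank e.2)%N && edge e.1 e.2].

Definition weight (e : V * V) : R := mu G e.1 e.2.

Definition gsize : R := \sum_(e in edges) weight e.

Definition min_weight_edges : {set V * V} :=
  [set e in edges | [forall e' in edges, weight e <= weight e']].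

(* The path x_0, ..., x_m is given by x = x_0 and p = [:: x_1; ...; x_m].
   The seed 1 is neutral for the minimum, since all weights are at most 1. *)
Definition strength (x : V) (p : seq V) : R :=
  foldr Num.min 1 (pairmap (mu G) x p).

Definition path_strengths (x y : V) : set R :=
  [set s | exists p, [/\ path edge x p, last x p = y & s = strength x p]]%classic.

(* The supremum is a maximum: see [CONN_attained] and [CONN_ge]. *)
Definition CONN (x y : V) : R := sup (path_strengths x y).

Definition strong (x y : V) : bool := edge x y && (mu G x y == CONN x y).

Definition Ns (x : V) : {set V} := [set y | strong x y].

Definition strong_edges : {set V * V} := [set e in edges | strong e.1 e.2].

(* In the next three minima and maxima the seeds 1 and 0 are neutral, weights
   being in [0, 1]; they are the values only when the index set is empty. *)
Definition mu_s (x : V) : R := \big[Num.min/1]_(y in Ns x) mu G x y.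

Definition mu_min : R := \big[Num.min/1]_(e in strong_edges) weight e.

Definition mu_max : R := \big[Num.max/0]_(e in strong_edges) weight e.

Definition fuzzy_cycle (n : nat) (u : 'I_n -> V) : Prop :=
  [/\ (3 <= n)%N, bijective u &
      forall i j, edge (u i) (u j) = (j == ordS i) || (i == ordS j)].

Definition SNRDF (f : {ffun V -> 'I_3}) : bool :=
  [forall x, (f x == 0%N :> nat) ==> [exists y in Ns x, f y == 2%N :> nat]].

Definition SNRDF_weight (f : {ffun V -> 'I_3}) : R :=
  \sum_x (f x)%:R * mu_s x.

(* The seed is the weight of the constant function 2, itself an SNRDF. *)
Definition gamma_snR : R :=
  \big[Num.min/SNRDF_weight [ffun=> ord_max]]_(f | SNRDF f) SNRDF_weight f.

Lemma SNRDF_const2 : SNRDF [ffun=> ord_max].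
Proof. by apply/forallP => x; rewrite ffunE. Qed.

Lemma strength_in x p :
  exists o : option (V * V), strength x p = if o is Some e then weight e else 1.
Proof.
elim: p x => [|y p IHp] x; first by exists None.
rewrite /strength /= -/(strength y p) minEle; case: ifP => _; last exact: IHp.
by exists (Some (x, y)).
Qed.

Lemma CONN_max x y p : path edge x p -> last x p = y ->
  path_strengths x y (CONN x y) /\ ubound (path_strengths x y) (CONN x y).
Proof.
move=> xp py; pose val o : R := if o is Some e then weight e else 1.
have [o0 vo0] := strength_in x p.
have Po0 : `[< path_strengths x y (val o0) >].
  by apply/asboolP; exists p; split.
case: (@arg_maxP _ _ _ o0 (fun o => `[< path_strengths x y (val o) >]) val Po0).
move=> o /asboolP Po maxo.
have ubo : ubound (path_strengths x y) (val o).
  move=> s Ps; have [q [_ _ sq]] := Ps; have [o' vo'] := strength_in x q.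
  have so' : s = val o' by rewrite sq vo'.
  by rewrite so'; apply: maxo; apply/asboolP; rewrite -so'.
suff -> : CONN x y = val o by [].
apply/le_anti/andP; split; first by apply: ge_sup => //; exists (val o).
by apply: ub_le_sup => //; exists (val o).
Qed.

Lemma CONN_attained x y p : path edge x p -> last x p = y ->
  exists2 q, path edge x q /\ last x q = y & CONN x y = strength x q.
Proof. by move=> xp /(CONN_max xp)[[q [? ? ?]] _]; exists q. Qed.

Lemma CONN_ge x y p : path edge x p -> last x p = y -> strength x p <= CONN x y.
Proof. by move=> xp py; have [_] := CONN_max xp py; apply; exists p. Qed.

End FuzzyGraph.

(* Main.v *)
Require Import Defs.
From mathcomp Require Import all_boot all_order all_algebra.
From mathcomp Require Import reals zify lra.

(* Since a minimum weight is attained on two edges, every edge is strong: deleting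
   an edge and another edge of minimum weight cuts the cycle in two arcs, so each
   path joining the ends of the first edge uses one of the two.  Hence mu_s at a
   vertex is at most the weight of each of its two edges.  Charging every vertex
   to its edge on the side of a minimum edge b, away from a maximum edge a, leaves
   a unused and uses b twice, so the sum of all mu_s is at most
   q - (mu_max - mu_min).  Finally, the n rotations of the function
   (0 2 0)^k 1^(n - 3k) are SNRDFs, of average weight (n - k)/n times that sum. *)

Set Implicit Arguments.
Unset Strict Implicit.
Unset Printing Implicit Defensive.

Import Order.TTheory GRing.Theory Num.Theory.
Local Open Scope ring_scope.

(** * Arithmetic of cyclic indices and sums over a full turn *)

Lemma ordS_add1 n (i : 'I_n.+2) : ordS i = i + 1.
Proof. by apply: val_inj; rewrite /= addn1. Qed.

Lemma val_ord_add1 n (i : 'I_n.+2) : i != -1 -> val (i + 1) = i.+1 :> nat.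
Proof.
move=> i_max; have := ltn_ord i; rewrite ltnS leq_eqVlt => /orP[/eqP i_n|i_n].
  case/eqP: i_max; apply/eqP; rewrite -subr_eq0 opprK; apply/eqP/val_inj.
  by rewrite -ordS_add1 /= i_n modnn.
by rewrite -ordS_add1 /= modn_small.
Qed.

Lemma sum_cyclic_shift (M : zmodType) n (F : 'I_n.+2 -> M) (a : 'I_n.+2) :
  \sum_(0 <= i < n.+2) F (a + i%:R) = \sum_i F i.
Proof.
rewrite big_mkord [RHS](reindex_inj (addrI a)) /=.
by apply: eq_bigr => i _; rewrite natr_Zp.
Qed.

Lemma sum_cyclic_min_le (R : realDomainType) n (s w : 'I_n.+2 -> R)
    (a b : 'I_n.+2) :
  (forall i, s i <= w i) -> (forall i, s (i + 1) <= w i) ->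
  \sum_i s i <= \sum_i w i - (w a - w b).
Proof.
move=> s_w sS_w; pose W i := w (a + i%:R); pose S i := s (a + 1 + i%:R).
have [d W_d] : exists d : 'I_n.+2, W d = w b.
  by exists (b - a); rewrite /W natr_Zp addrC subrK.
have W_0 : W 0%N = w a by rewrite /W addr0.
have SW i : S i <= W i by rewrite /W /S addrAC.
have SWS i : S i <= W i.+1 by rewrite /W mulrS addrA; apply: s_w.
have d_lt := ltn_ord d.
(* Rotated so that [a] sits at 0 and [b] at [d]: [S i] is charged to [W i.+1] for [i < d] and to
   [W i] from [d] on. This misses [W 0] and uses [W d] twice. *)
have -> : \sum_i s i = \sum_(0 <= i < d) S i + \sum_(d <= i < n.+2) S i.
  by rewrite -big_cat_nat ?[RHS]sum_cyclic_shift // ltnW.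
have -> : \sum_i w i =
    W 0%N + \sum_(0 <= i < d) W i.+1 + \sum_(d.+1 <= i < n.+2) W i.
  by rewrite -big_nat_recl // -big_cat_nat // [RHS]sum_cyclic_shift.
rewrite -W_d -W_0.
have le1 : \sum_(0 <= i < d) S i <= \sum_(0 <= i < d) W i.+1.
  by apply: ler_sum => i _.
have le2 : \sum_(d <= i < n.+2) S i <= \sum_(d <= i < n.+2) W i.
  by apply: ler_sum => i _.
by move: le2; rewrite (big_ltn (F := W)) //; lra.
Qed.

(** * Cuts, path strength and strong edges *)

(** [zip (x :: p) p] lists the steps of the path; the first step on which [S] changes is the
    witness. *)
Lemma path_exits (T : eqType) (e : rel T) (S : pred T) x p :
  path e x p -> S x != S (last x p) ->
  exists2 yz, yz \in zip (x :: p) p & e yz.1 yz.2 /\ S yz.1 != S yz.2.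
Proof.
elim: p x => [|y p IHp] x /=; first by rewrite eqxx.
case/andP=> xy yp Sxl; have [Sxy|Sxy] := eqVneq (S x) (S y).
  rewrite Sxy in Sxl; have [yz yzp ?] := IHp _ yp Sxl.
  by exists yz => //; rewrite inE yzp orbT.
by exists (x, y) => //; rewrite mem_head.
Qed.

Section Graph.
Context {R : realType} {V : finType} (G : fuzzyGraph R V).

Lemma strength_le_step x p yz :
  yz \in zip (x :: p) p -> strength G x p <= mu G yz.1 yz.2.
Proof.
elim: p x => [|y p IHp] x //; rewrite inE /strength /= -/(strength G y p).
by case/predU1P=> [->|/IHp] /=; rewrite ge_min ?lexx // => ->; rewrite orbT.
Qed.

Lemma CONN_ge_mu x y : edge G x y -> mu G x y <= CONN G x y.
Proof.
move=> xy; have := @CONN_ge _ _ G x y [:: y]; rewrite /= xy => /(_ isT erefl).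
by rewrite /strength /= min_l //; case/andP: (mu_bound G x y).
Qed.

Lemma mu_s_le x y : strong G x y -> mu_s G x <= mu G x y.
Proof. by move=> xy; apply: bigmin_le_cond; rewrite inE. Qed.

Lemma gamma_snR_le f : SNRDF G f -> gamma_snR G <= SNRDF_weight G f.
Proof. by move=> fP; apply: bigmin_le_cond. Qed.

(** A path from [x] to [y] of maximum strength crosses the cut [S], and its strength is at most the
    weight of the crossing edge, hence at most [mu G x y]. *)
Lemma strong_by_cut (S : pred V) x y : edge G x y -> S x != S y ->
  (forall a b, edge G a b -> S a != S b -> mu G a b <= mu G x y) ->
  strong G x y.
Proof.
move=> xy Sxy cut; rewrite /strong xy eq_le CONN_ge_mu //=.
have [|//|p [xp py] ->] := @CONN_attained _ _ G x y [:: y].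
  by rewrite /= xy.
rewrite -py in Sxy; have [yz yzp [e_yz Syz]] := path_exits xp Sxy.
exact: le_trans (strength_le_step yzp) (cut _ _ e_yz Syz).
Qed.

End Graph.

(** * Edges of a fuzzy cycle, indexed by their first end *)

(** The orientation by [enum_rank] is the one that selects representatives in [edges]. *)
Definition cycle_edge (V : finType) n (u : 'I_n.+3 -> V) (i : 'I_n.+3) : V * V :=
  if (enum_rank (u i) < enum_rank (u (i + 1)%R))%N
  then (u i, u (i + 1)) else (u (i + 1), u i).

Section Cycle.
Context {R : realType} {V : finType} (G : fuzzyGraph R V).
Context {n : nat} (u : 'I_n.+3 -> V).
Hypothesis hu : fuzzy_cycle G u.

Let u_inj : injective u.
Proof. by case: hu => _ /bij_inj. Qed.

Lemma edge_cycle i j : edge G (u i) (u j) = (j == i + 1) || (i == j + 1).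
Proof. by case: hu => _ _ ->; rewrite !ordS_add1. Qed.

Lemma edge_cycleS i : edge G (u i) (u (i + 1)).
Proof. by rewrite edge_cycle eqxx. Qed.

Lemma weight_cycle_edge i : weight G (cycle_edge u i) = mu G (u i) (u (i + 1)).
Proof. by rewrite /weight /cycle_edge; case: ifP => //= _; rewrite mu_sym. Qed.

Lemma edge_cycleP (P : V -> V -> Prop) :
  (forall i, P (u i) (u (i + 1))) -> (forall i, P (u (i + 1)) (u i)) ->
  forall x y, edge G x y -> P x y.
Proof.
move=> P1 P2 x y; have [_ [v uK vK] _] := hu.
by rewrite -[x]vK -[y]vK edge_cycle => /orP[]/eqP->.
Qed.

Lemma cycle_edge_inj : injective (cycle_edge u).
Proof.
(* Two indices giving the same edge in opposite directions would be successors of each other,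
   forcing 2 = 0 modulo the length, which is at least 3. *)
have two_neq0 : (1 + 1 : 'I_n.+3) <> 0 by [].
have aux (i j : 'I_n.+3) : i = j + 1 -> i + 1 = j -> i = j.
  move=> -> /eqP; rewrite -addrA -subr_eq0 addrAC subrr add0r.
  by move=> /eqP/two_neq0.
move=> i j; rewrite /cycle_edge; case: ifP => _; case: ifP => _ [].
- by move=> /u_inj.
- by move=> /u_inj ij /u_inj; apply: aux.
- by move=> /u_inj ij /u_inj /aux; apply.
- by move=> _ /u_inj.
Qed.

Lemma edges_cycle : edges G = [set cycle_edge u i | i : 'I_n.+3].
Proof.
apply/setP => -[x y]; rewrite inE; apply/andP/imsetP => /= [[]|[i _]].
  move=> + xy; move: x y xy.
  apply: edge_cycleP => i lt_i; exists i => //; rewrite /cycle_edge ?lt_i //.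
  by rewrite ltnNge ltnW.
rewrite /cycle_edge; have ui := edge_cycleS i.
case: ltnP => [lt_i [-> ->] // | le_i [-> ->]].
rewrite [edge _ _ _]/(edge G (u (i + 1)) (u i)) /edge mu_sym -/(edge _ _ _) ui.
split=> //; rewrite ltn_neqAle le_i andbT; apply/eqP => /val_inj/enum_rank_inj.
by move=> uE; move: ui; rewrite /edge uE mu_diag ltxx.
Qed.

Lemma gsize_cycle : gsize G = \sum_i mu G (u i) (u (i + 1)).
Proof.
rewrite /gsize edges_cycle big_imset /=; last exact: in2W cycle_edge_inj.
by under eq_bigr do rewrite weight_cycle_edge; apply: eq_bigl.
Qed.

Lemma min_weight_cycle_edge i : cycle_edge u i \in min_weight_edges G ->
  forall j, mu G (u i) (u (i + 1)) <= mu G (u j) (u (j + 1)).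
Proof.
rewrite inE => /andP[_ /forall_inP min_i] j.
by rewrite -!weight_cycle_edge min_i // edges_cycle imset_f.
Qed.

Lemma exists_min_weight a : (2 <= #|min_weight_edges G|)%N ->
  exists2 b, b != a & forall j, mu G (u b) (u (b + 1)) <= mu G (u j) (u (j + 1)).
Proof.
rewrite (cardsD1 (cycle_edge u a)) => card2.
have /card_gt0P[e] : (0 < #|min_weight_edges G :\ cycle_edge u a|)%N.
  by move: card2; case: (_ \in _); [rewrite add1n | apply: ltnW].
rewrite 2!inE => /andP[e_a e_min].
have : e \in edges G by move: e_min; rewrite inE => /andP[].
rewrite edges_cycle => /imsetP[b _ def_e]; rewrite def_e in e_a e_min.
by exists b; [apply: contraNneq e_a => -> | apply: min_weight_cycle_edge].
Qed.

Lemma edge_strong x y : (2 <= #|min_weight_edges G|)%N ->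
  edge G x y -> strong G x y.
Proof.
move=> card2.
have [_ [v uK vK] _] := hu.
suff strongE a : exists2 S : pred V, S (u a) != S (u (a + 1)) &
    forall x y, edge G x y -> S x != S y -> mu G x y <= mu G (u a) (u (a + 1)).
  move: x y; apply: edge_cycleP => a; have [S Sa Sle] := strongE a.
    by apply: (@strong_by_cut _ _ G S) => //; apply: edge_cycleS.
  apply: (@strong_by_cut _ _ G S); rewrite 1?eq_sym //.
    by rewrite /edge mu_sym; apply: edge_cycleS.
  by move=> c d cd Scd; rewrite [leRHS]mu_sym Sle.
have [b b_a b_min] := exists_min_weight a card2.
(* [S] is the arc from u_(a+1) to u_b; indices are read cyclically from a + 1. *)
pose m : 'I_n.+3 := b - (a + 1).
pose S z := ((v z - (a + 1))%R <= m)%N.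
have S_u j : S (u j) = ((j - (a + 1))%R <= m)%N by rewrite /S uK.
(* The position [c] of [j] wraps around only at -1, that is at [j = a]; elsewhere [c] and [c + 1]
   lie on different sides of [m] only if [c = m], that is [j = b]. *)
have jump j : S (u j) != S (u (j + 1)) -> j = a \/ j = b.
  rewrite !S_u [j + 1 - _]addrAC; set c := j - (a + 1).
  have [c_max _|c_max] := eqVneq c (-1).
    by left; apply: (@addIr _ 1); apply: subr0_eq; rewrite addrAC -/c c_max addNr.
  rewrite val_ord_add1 // => c_m; right; apply: (@addIr _ (- (a + 1))).
  apply: ord_inj; rewrite -/c -/m.
  by case: (ltngtP c m) c_m.
exists S.
  (* [u (a + 1)] has position 0, inside the arc; [u a] has the last position [n.+2], outside it
     because [b != a] gives [m < n.+2]. *)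
  have Na : a - (a + 1) = -1 by rewrite opprD addrA subrr add0r.
  have m_max : m != -1.
    by apply: contraNneq b_a => m_max; apply/eqP/(@addIr _ (- (a + 1))); rewrite Na -m_max.
  have m_lt : (m < n.+2)%N by rewrite -ltnS -(val_ord_add1 m_max) ltn_ord.
  rewrite !S_u Na subrr leq0n eqb_id -ltnNge.
  have -> // : (-1 : 'I_n.+3) = n.+2 :> nat.
  by rewrite /= (@modn_small 1) // subn1 modn_small.
apply: edge_cycleP => j; first by case/jump=> ->.
by rewrite eq_sym mu_sym => /jump[]->.
Qed.

Lemma mu_s_cycle_le i : (2 <= #|min_weight_edges G|)%N ->
  mu_s G (u i) <= mu G (u i) (u (i + 1)) /\
  mu_s G (u (i + 1)) <= mu G (u i) (u (i + 1)).
Proof.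
move=> card2; split; last rewrite mu_sym; apply/mu_s_le/edge_strong => //.
  exact: edge_cycleS.
by rewrite /edge mu_sym; apply: edge_cycleS.
Qed.

Lemma sum_mu_s_cycle_le : (2 <= #|min_weight_edges G|)%N ->
  \sum_x mu_s G x <= gsize G - (mu_max G - mu_min G).
Proof.
move=> card2; pose w i := mu G (u i) (u (i + 1)).
have [_ u_bij _] := hu.
have [b _ b_min] := exists_min_weight 0 card2.
have [a _ a_max] := @arg_maxP _ _ _ ord0 xpredT w isT.
(* Strong edges are cycle edges, so [w a] and [w b] bound the extrema over them; the seeds 0 and 1
   are compared separately. *)
have max_le : mu_max G <= w a.
  apply: bigmax_le => [|e]; first by case/andP: (mu_bound G (u a) (u (a + 1))).
  rewrite inE edges_cycle => /andP[/imsetP[i _ ->] _].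
  by rewrite weight_cycle_edge; apply: a_max.
have min_ge : w b <= mu_min G.
  apply: le_bigmin => [|e]; first by case/andP: (mu_bound G (u b) (u (b + 1))).
  rewrite inE edges_cycle => /andP[/imsetP[i _ ->] _].
  by rewrite weight_cycle_edge b_min.
have le_mu i := mu_s_cycle_le i card2.
rewrite gsize_cycle (reindex u) /=; last exact: onW_bij.
apply: le_trans (@sum_cyclic_min_le _ _ _ w a b _ _) _.
- by move=> i; have [] := le_mu i.
- by move=> i; have [] := le_mu i.
- by rewrite lerD2l lerN2 lerB.
Qed.

End Cycle.

(** * Roman patterns and the average over their rotations *)

Definition roman_pattern (k i : nat) : nat :=
  if (i < 3 * k)%N then (if i %% 3 == 1 then 2 else 0)%N else 1%N.

Lemma roman_pattern_lt3 k i : (roman_pattern k i < 3)%N.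
Proof. by rewrite /roman_pattern; do 2?case: ifP. Qed.

(** Each of the [k] blocks 0 2 0 contributes 2 and each later position 1, so the total is 2k + (n -
    3k). *)
Lemma sum_roman_pattern k n : (3 * k <= n)%N ->
  (\sum_(0 <= i < n) roman_pattern k i = n - k)%N.
Proof.
move=> k_n; rewrite (@big_cat_nat _ _ _ (3 * k)) //=.
have -> : (\sum_(3 * k <= i < n) roman_pattern k i = n - 3 * k)%N.
  rewrite -[RHS]muln1 -sum_nat_const_nat; apply: eq_big_nat => i /andP[k_i _].
  by rewrite /roman_pattern ltnNge k_i.
have -> : (\sum_(0 <= i < 3 * k) roman_pattern k i =
    \sum_(0 <= i < 3 * k) (if i %% 3 == 1 then 2 else 0))%N.
  by apply: eq_big_nat => i /andP[_ i_k]; rewrite /roman_pattern i_k.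
suff -> : (\sum_(0 <= i < 3 * k) (if i %% 3 == 1 then 2 else 0) = 2 * k)%N by lia.
elim: k {k_n} => [|k IHk]; first by rewrite big_geq.
rewrite mulnS addnC !addnS addn0 !big_nat_recr //= IHk.
have -> : ((3 * k) %% 3 == 1)%N = false by lia.
have -> : ((3 * k).+1 %% 3 == 1)%N by lia.
have -> : ((3 * k).+2 %% 3 == 1)%N = false by lia.
by lia.
Qed.

(** Each 0 is next to the 2 of its own block: on its right at residue 0, on its left at residue 2.
    The bound on [i.+1] ensures that this neighbor is reached without wrapping around the cycle. *)
Lemma roman_pattern_eq0 k i : roman_pattern k i = 0%N ->
  (i.+1 < 3 * k /\ roman_pattern k i.+1 = 2 \/
   exists2 j, i = j.+1 & roman_pattern k j = 2)%N.
Proof.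
rewrite /roman_pattern; case: ltnP => // i_k; case: eqP => // i_mod _.
have [i0|i0] := eqVneq (i %% 3)%N 0%N.
  have Si_k : (i.+1 < 3 * k)%N by lia.
  left; rewrite Si_k; split=> //; case: eqP => //; lia.
right; exists i.-1; first by lia.
have -> : (i.-1 < 3 * k)%N by lia.
by case: eqP => //; lia.
Qed.

(** Summing over all rotations, each vertex meets every entry of the pattern exactly once, so its
    [mu_s] gets the coefficient [n.+3 - k]. *)
Lemma gamma_snR_cycle_le (R : realType) (V : finType) (G : fuzzyGraph R V)
    n (u : 'I_n.+3 -> V) k :
  fuzzy_cycle G u -> (2 <= #|min_weight_edges G|)%N -> (3 * k <= n.+3)%N ->
  n.+3%:R * gamma_snR G <= (n.+3 - k)%:R * \sum_x mu_s G x.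
Proof.
move=> hu card2 k_n; have [_ u_bij _] := hu; have [v uK vK] := u_bij.
pose f (r : 'I_n.+3) : {ffun V -> 'I_3} :=
  [ffun x => Ordinal (roman_pattern_lt3 k (v x - r)%R)].
have fE r x : f r x = roman_pattern k (v x - r)%R :> nat by rewrite ffunE.
have fP r : SNRDF G (f r).
  have strong_uv (c d : 'I_n.+3) : c = d + 1 \/ d = c + 1 -> strong G (u c) (u d).
    move=> cd; apply: (edge_strong hu card2).
    by rewrite (edge_cycle hu); case: cd => ->; rewrite eqxx ?orbT.
  apply/forallP=> x; apply/implyP => /eqP; rewrite fE.
  set c := v x - r => /roman_pattern_eq0 fc0.
  suff [d [d_adj d2]] : exists d : 'I_n.+3,
      (c = d + 1 \/ d = c + 1) /\ roman_pattern k d = 2%N.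
    apply/existsP; exists (u (d + r)); rewrite inE fE uK addrK d2 andbT.
    rewrite -[x]vK; apply: strong_uv; rewrite -(subrK r (v x)) -/c.
    by case: d_adj => ->; [left | right]; rewrite addrAC.
  case: fc0 => [[c_k c2]|[j c_j j2]].
    exists (c + 1); split; first by right.
    by rewrite -ordS_add1 /= modn_small // (leq_trans c_k).
  have j_n : (j < n.+3)%N by have := ltn_ord c; rewrite c_j; apply: ltnW.
  exists (Ordinal j_n); split=> //; left; apply: ord_inj.
  by rewrite -ordS_add1 [RHS]/= -c_j modn_small.
have le_f r := gamma_snR_le (fP r).
apply: (@le_trans _ _ (\sum_r SNRDF_weight G (f r))).
  rewrite -[X in X%:R * _](card_ord n.+3) mulr_natl -sumr_const.
  exact: ler_sum.
rewrite /SNRDF_weight exchange_big /= mulr_sumr.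
apply: ler_sum => x _; rewrite -mulr_suml le_eqVlt; apply/orP; left; apply/eqP.
congr (_ * _); rewrite -(sum_roman_pattern k_n) big_mkord natr_sum.
(* For fixed [x], the map sending [r] to [v x - r] permutes the indices. *)
rewrite [RHS](reindex_inj (addrI (v x))) [RHS](reindex_inj oppr_inj) /=.
by apply: eq_bigr => r _; rewrite fE.
Qed.

Theorem theorem4p3 (R : realType) (V : finType) (G : fuzzyGraph R V)
    (n k : nat) (u : 'I_n -> V) :
  (1 <= n)%N -> (1 <= k)%N -> k = (n %/ 3)%N ->
  fuzzy_cycle G u ->
  (2 <= #|min_weight_edges G|)%N ->
  gamma_snR G <=
    (1 - k%:R / n%:R) * (gsize G - (mu_max G - mu_min G)).
Proof.
move=> _ _ k_def hu card2; have [n_ge3 _ _] := hu.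
(* Exposing three successors gives the index type its cyclic addition. *)
case: n => [|[|[|n]]] // in u k_def hu n_ge3 *.
have k_n : (3 * k <= n.+3)%N by lia.
have n_gt0 : 0 < n.+3%:R :> R by rewrite ltr0n.
have -> : 1 - k%:R / n.+3%:R = (n.+3 - k)%:R / n.+3%:R :> R.
  by rewrite natrB ?mulrBl ?divff ?gt_eqF //; lia.
rewrite mulrAC ler_pdivlMr // mulrC.
apply: le_trans (gamma_snR_cycle_le hu card2 k_n) _.
by rewrite ler_wpM2l // (sum_mu_s_cycle_le hu card2).
Qed.
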